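(* Let $\alpha\in[0,\frac{\pi}{2})$ with $\alpha \ne 0$, and let $A \in \prod_{1,\alpha}^n$ satisfy $\|\Re(A)\|\le\|\Im(A)\|$. Then \begin{equation*} \frac{1}{4\sin^2(\alpha)}\|A^*A+AA^*\| \le w^2(A). \end{equation*}
   Context: $M_n$ ($n\ge 1$) is the algebra of $n\times n$ complex matrices acting on $\mathbb{C}^n$ with operator norm $\|\cdot\|$. $\Re(A)=\frac{A+A^*}{2}$ and $\Im(A)=\frac{A-A^*}{2i}$. $W(A)=\{\langle Ax,x\rangle: x\in\mathbb{C}^n,\ \|x\|=1\}$, $w(A)=\sup\{|z|:z\in W(A)\}$, and $w^2(A)=(w(A))^2$. For $\alpha\in[0,\frac{\pi}{2})$ let $S_\alpha=\{z\in\mathbb{C}:\Re z>0,\ |\Im z|\le\tan(\alpha)\,\Re z\}$. $\prod_{1,\alpha}^n$ denotes the set of $A\in M_n$ with $W(A)\subseteq S_\alpha$. *)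

(* Defs.v *)
From HB Require Import structures.
From mathcomp Require Import all_boot all_order all_algebra.
From mathcomp Require Import all_classical all_reals all_analysis.
From mathcomp Require Export complex.

Set Implicit Arguments.
Unset Strict Implicit.
Unset Printing Implicit Defensive.

Import Order.TTheory GRing.Theory Num.Theory.
Local Open Scope classical_set_scope.
Local Open Scope ring_scope.
Local Open Scope sesquilinear_scope.

(* Linear in the first argument, conjugate-linear in the second. *)
Definition inner (R : realType) (n : nat) (x y : 'cV[R[i]]_n) : R[i] :=
  \sum_(i < n) x i 0 * (y i 0)^*.

Definition vnorm (R : realType) (n : nat) (x : 'cV[R[i]]_n) : R :=
  Num.sqrt (\sum_(i < n) ComplexField.Normc.normc (x i 0) ^+ 2).

Definition usphere (R : realType) (n : nat) : set 'cV[R[i]]_n :=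
  [set x | vnorm x = 1].

(* For n = 0 the unit sphere is empty and this is sup set0 = 0. *)
Definition opnorm (R : realType) (n : nat) (A : 'M[R[i]]_n) : R :=
  sup [set vnorm (A *m x) | x in @usphere R n].

Definition adjmx (R : realType) (n : nat) (A : 'M[R[i]]_n) : 'M[R[i]]_n :=
  A ^t*.

Definition Remx (R : realType) (n : nat) (A : 'M[R[i]]_n) : 'M[R[i]]_n :=
  2^-1 *: (A + adjmx A).

Definition Immx (R : realType) (n : nat) (A : 'M[R[i]]_n) : 'M[R[i]]_n :=
  (2 * 'i%C)^-1 *: (A - adjmx A).

Definition numrange (R : realType) (n : nat) (A : 'M[R[i]]_n) : set R[i] :=
  [set inner (A *m x) x | x in @usphere R n].

Definition numradius (R : realType) (n : nat) (A : 'M[R[i]]_n) : R :=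
  sup [set ComplexField.Normc.normc z | z in numrange A].

Definition sector (R : realType) (alpha : R) : set R[i] :=
  [set z | 0 < complex.Re z /\
           `|complex.Im z| <= tan alpha * complex.Re z].

Definition sectorial (R : realType) (n : nat) (alpha : R) : set 'M[R[i]]_n :=
  [set A | numrange A `<=` sector alpha].

(* Main.v *)
Require Import Defs.
From mathcomp Require Import all_boot all_order all_algebra.
From mathcomp Require Import all_classical all_reals all_analysis.
From mathcomp Require Import ring lra.

Import Order.TTheory GRing.Theory Num.Theory.
Local Open Scope classical_set_scope.
Local Open Scope ring_scope.
Local Open Scope complex_scope.

(** Put H = Re A and K = Im A, both Hermitian. Everything reduces to the
    estimate ||K|| <= sin(alpha) w(A). For a unit vector x the number
    z = <Ax, x> lies in the sector, and there |Im z| <= sin(alpha) |z|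
    ([sector_Im_le]); as <Kx, x> = Im z, the quadratic form of K is bounded by
    sin(alpha) w(A) on the unit sphere, and for a Hermitian matrix such a bound
    is a bound on the operator norm ([hermitian_norm_le_form]).

    By hypothesis ||H|| <= ||K||, so H obeys the same estimate. The matrix
    A^*A + AA^* is Hermitian too, and its form at a unit vector x is
    ||Ax||^2 + ||A^*x||^2 = 2 (||Hx||^2 + ||Kx||^2), by the parallelogram law
    for Ax = Hx + iKx and A^*x = Hx - iKx ([sqr_vnorm_Remx_Immx]). It is
    therefore at most 4 (sin(alpha) w(A))^2, and [hermitian_norm_le_form]
    applied a second time turns this into the claimed bound on the norm. *)

Local Notation normc := ComplexField.Normc.normc.

(** * Moduli of complex numbers *)

Lemma real_normc (R : realType) (z : R[i]) : (normc z)%:C = `|z|.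
Proof. by []. Qed.

Lemma conj_real (R : realType) (r : R) : Num.conj (r%:C) = r%:C.
Proof. exact: conjc_real. Qed.

Lemma normc_ge0 (R : realType) (z : R[i]) : 0 <= normc z.
Proof. by case: z => a b; exact: sqrtr_ge0. Qed.

Lemma normc_real (R : realType) (r : R) : normc r%:C = `|r|.
Proof. by rewrite /= expr0n addr0 sqrtr_sqr. Qed.

Lemma normc_nat (R : realType) (k : nat) : normc (k%:R : R[i]) = k%:R.
Proof. by rewrite -(rmorph_nat (real_complex R)) normc_real normr_nat. Qed.

Lemma normc_i (R : realType) : normc ('i : R[i]) = 1.
Proof. by rewrite /= expr0n expr1n add0r sqrtr1. Qed.

Lemma normc_sum (R : realType) (I : finType) (F : I -> R[i]) :
  normc (\sum_i F i) <= \sum_i normc (F i).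
Proof.
elim/big_ind2: _ => [|x a y b xa yb|//]; first by rewrite normc_real normr0.
apply: (le_trans _ (lerD xa yb)); exact: le_normcD.
Qed.

Lemma sum_sqr_le_sqr_sum (R : realType) (I : finType) (F : I -> R) :
  (forall i, 0 <= F i) -> \sum_i F i ^+ 2 <= (\sum_i F i) ^+ 2.
Proof.
move=> F0; rewrite [leRHS]expr2 mulr_suml; apply: ler_sum => i _.
by rewrite expr2 ler_wpM2l // (bigD1 i) //= lerDl sumr_ge0.
Qed.

(** * The inner product and its norm *)

Section Inner.
Context {R : realType} {n : nat}.
Implicit Types (x y z : 'cV[R[i]]_n) (A K : 'M[R[i]]_n).

Lemma innerDl x y z : inner (x + y) z = inner x z + inner y z.
Proof. by rewrite -big_split /=; apply: eq_bigr => i _; rewrite mxE mulrDl. Qed.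

Lemma innerZl a x y : inner (a *: x) y = a * inner x y.
Proof. by rewrite mulr_sumr; apply: eq_bigr => i _; rewrite mxE mulrA. Qed.

Lemma conj_inner x y : Num.conj (inner x y) = inner y x.
Proof.
rewrite rmorph_sum; apply: eq_bigr => i _ /=.
by rewrite rmorphM /= conjCK mulrC.
Qed.

Lemma innerDr x y z : inner z (x + y) = inner z x + inner z y.
Proof. by rewrite -conj_inner innerDl rmorphD /= !conj_inner. Qed.

Lemma innerZr a x y : inner x (a *: y) = Num.conj a * inner x y.
Proof. by rewrite -conj_inner innerZl rmorphM /= !conj_inner. Qed.

Lemma innerBl x y z : inner (x - y) z = inner x z - inner y z.
Proof. by rewrite innerDl -(scaleN1r y) innerZl mulN1r. Qed.

Lemma innerBr x y z : inner z (x - y) = inner z x - inner z y.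
Proof. by rewrite -conj_inner innerBl rmorphB /= !conj_inner. Qed.

Lemma inner_adjmx A x y : inner (A *m x) y = inner x (adjmx A *m y).
Proof.
rewrite /inner; under eq_bigr do rewrite mxE mulr_suml.
rewrite exchange_big; apply: eq_bigr => j _ /=.
rewrite mxE rmorph_sum mulr_sumr; apply: eq_bigr => i _ /=.
by rewrite !mxE rmorphM /= conjCK mulrA [x j 0 * _]mulrC.
Qed.

Lemma adjmxK A : adjmx (adjmx A) = A.
Proof. by apply/matrixP => i j; rewrite !mxE conjCK. Qed.

Lemma inner_vnorm x : inner x x = (vnorm x ^+ 2)%:C.
Proof.
rewrite sqr_sqrtr; last by apply: sumr_ge0 => i _; exact: sqr_ge0.
rewrite rmorph_sum; apply: eq_bigr => i _.
by rewrite rmorphXn /= real_normc normCK.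
Qed.

Lemma vnorm_ge0 x : 0 <= vnorm x.
Proof. exact: sqrtr_ge0. Qed.

Lemma vnormZ a x : vnorm (a *: x) = normc a * vnorm x.
Proof.
apply/eqP; rewrite -(@eqrXn2 _ 2) ?mulr_ge0 ?vnorm_ge0 ?normc_ge0 //.
apply/eqP/complexI; rewrite -inner_vnorm innerZl innerZr exprMn rmorphM /=.
by rewrite -inner_vnorm mulrA rmorphXn /= real_normc normCK.
Qed.

Lemma vnorm_parallelogram x y :
  vnorm (x + y) ^+ 2 + vnorm (x - y) ^+ 2 = 2 * (vnorm x ^+ 2 + vnorm y ^+ 2).
Proof.
apply/complexI; rewrite raddfD rmorphM rmorph_nat raddfD /= -!inner_vnorm.
by rewrite !innerBr !innerDr !innerBl !innerDl; ring.
Qed.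

Lemma vnorm_eq0 x : vnorm x = 0 -> x = 0.
Proof.
move=> /eqP; rewrite sqrtr_eq0 => x_le0; apply/matrixP => i j; rewrite ord1 mxE.
apply: ComplexField.Normc.eq0_normc; apply/eqP.
rewrite -sqrf_eq0 eq_le sqr_ge0 andbT; apply: le_trans x_le0.
by rewrite (bigD1 i) //= lerDl sumr_ge0 // => k _; exact: sqr_ge0.
Qed.

(** * Quadratic forms of Hermitian matrices *)

(** The vectors produced by polarization are not of unit length (one of them
    may vanish), so the bound on the sphere is needed in homogeneous form. *)
Lemma form_le_sqr_vnorm A (c : R) :
  (forall x, vnorm x = 1 -> normc (inner (A *m x) x) <= c) ->
  forall x, normc (inner (A *m x) x) <= c * vnorm x ^+ 2.
Proof.
move=> Ac x; have [/vnorm_eq0->|x_neq0] := eqVneq (vnorm x) 0.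
  have z0 : inner (A *m 0) 0 = 0 by rewrite mulmx0 -(scale0r 0) innerZl mul0r.
  have v0 : vnorm (0 : 'cV[R[i]]_n) = 0.
    apply/eqP; rewrite -sqrf_eq0; apply/eqP/complexI.
    by rewrite -inner_vnorm -[in LHS](scale0r 0) innerZl mul0r.
  by rewrite z0 v0 expr0n mulr0 normc_real normr0.
have x_gt0 : 0 < vnorm x by rewrite lt_def x_neq0 vnorm_ge0.
pose u := (vnorm x)^-1%:C *: x.
have u1 : vnorm u = 1.
  by rewrite vnormZ normc_real gtr0_norm ?invr_gt0 // mulVf.
have -> : x = (vnorm x)%:C *: u.
  by rewrite scalerA -rmorphM /= mulfV // scale1r.
rewrite vnormZ u1 mulr1 -scalemxAr innerZl innerZr conj_real.
by rewrite !ComplexField.Normc.normcM mulrA -expr2 mulrC ler_wpM2r ?sqr_ge0 ?Ac.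
Qed.

(** Polarization: for a unit vector y, <K(x+y), x+y> - <K(x-y), x-y> equals
    4 Re <Kx, y> because K is Hermitian, while the parallelogram law bounds it
    by c (||x+y||^2 + ||x-y||^2) = 4 c. Taking y to be Kx normalized makes
    <Kx, y> equal to ||Kx||. *)
Lemma hermitian_norm_le_form K (c : R) :
  adjmx K = K ->
  (forall x, vnorm x = 1 -> normc (inner (K *m x) x) <= c) ->
  forall x, vnorm x = 1 -> vnorm (K *m x) <= c.
Proof.
move=> Kherm Kc x x1; set m := vnorm (K *m x).
have [m0|m_neq0] := eqVneq m 0.
  by rewrite m0; apply: le_trans (Kc x x1); exact: normc_ge0.
have m_gt0 : 0 < m by rewrite lt_def m_neq0 vnorm_ge0.
pose y := m^-1%:C *: (K *m x).
have y1 : vnorm y = 1.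
  by rewrite vnormZ -/m normc_real gtr0_norm ?invr_gt0 // mulVf.
have cross : inner (K *m (x + y)) (x + y) - inner (K *m (x - y)) (x - y)
    = (4 * m)%:C.
  have xy : inner (K *m x) y = m%:C.
    rewrite innerZr inner_vnorm -/m conj_real -rmorphM /=.
    by rewrite expr2 mulKf.
  have yx : inner (K *m y) x = m%:C.
    by rewrite inner_adjmx Kherm -conj_inner xy conj_real.
  rewrite mulmxDr mulmxBr !innerBr !innerDr !innerBl !innerDl xy yx.
  by rewrite rmorphM rmorph_nat /=; ring.
have := vnorm_parallelogram x y; rewrite x1 y1 expr1n => pl.
have cross_le : 4 * m <= c * vnorm (x + y) ^+ 2 + c * vnorm (x - y) ^+ 2.
  rewrite -[leLHS]gtr0_norm ?mulr_gt0 // -normc_real -cross.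
  apply: le_trans (le_normcD _ _) _; rewrite normcN.
  by apply: lerD; exact: form_le_sqr_vnorm.
by rewrite -mulrDr pl in cross_le; lra.
Qed.

(** * Operator norm and numerical radius as suprema *)

Lemma vnorm_le_sum x : vnorm x <= \sum_i normc (x i 0).
Proof.
have s_ge0 : 0 <= \sum_i normc (x i 0).
  by apply: sumr_ge0 => i _; exact: normc_ge0.
rewrite -[leRHS]ger0_norm // -sqrtr_sqr ler_wsqrtr //.
by apply: sum_sqr_le_sqr_sum => i; exact: normc_ge0.
Qed.

Lemma normc_le_vnorm x i : normc (x i 0) <= vnorm x.
Proof.
rewrite -[leLHS]ger0_norm ?normc_ge0 // -sqrtr_sqr ler_wsqrtr //.
by rewrite (bigD1 i) //= lerDl sumr_ge0 // => k _; exact: sqr_ge0.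
Qed.

(** A crude bound, uniform over the unit sphere: it shows that the suprema
    defining the operator norm and the numerical radius are finite, without
    which they would not be upper bounds. *)
Lemma sum_normc_mulmx A x : vnorm x = 1 ->
  \sum_i normc ((A *m x) i 0) <= \sum_i \sum_j normc (A i j).
Proof.
move=> x1; apply: ler_sum => i _; rewrite mxE.
apply: le_trans (normc_sum _ _ _) _; apply: ler_sum => j _.
by rewrite ComplexField.Normc.normcM ler_piMr ?normc_ge0 // -x1 normc_le_vnorm.
Qed.

Lemma opnorm_ub A x : vnorm x = 1 -> vnorm (A *m x) <= opnorm A.
Proof.
move=> x1; apply: ub_le_sup; last by exists x.
exists (\sum_i \sum_j normc (A i j)) => _ [y y1 <-].
exact: le_trans (vnorm_le_sum _) (sum_normc_mulmx _ _ y1).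
Qed.

Lemma numradius_ub A x :
  vnorm x = 1 -> normc (inner (A *m x) x) <= numradius A.
Proof.
move=> x1; apply: ub_le_sup; last by exists (inner (A *m x) x) => //; exists x.
exists (\sum_i \sum_j normc (A i j)) => _ [_ [y y1 <-] <-].
apply: le_trans (sum_normc_mulmx _ _ y1).
apply: le_trans (normc_sum _ _ _) _; apply: ler_sum => i _.
rewrite ComplexField.Normc.normcM ler_piMr ?normc_ge0 //.
rewrite -y1; apply: le_trans (normc_le_vnorm y i).
by rewrite -[X in normc X]/(conjc _); case: (y i 0) => a b /=; rewrite sqrrN.
Qed.

(** A positive dimension provides a unit vector: the supremum of a nonempty set
    lies below each of its upper bounds, whatever their sign. *)
Lemma opnorm_le A (c : R) : (0 < n)%N ->
  (forall x, vnorm x = 1 -> vnorm (A *m x) <= c) -> opnorm A <= c.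
Proof.
move=> n0 Ac; apply: ge_sup => [|_ [x x1 <-]]; last exact: Ac.
pose e : 'cV[R[i]]_n := delta_mx (Ordinal n0) 0.
have e1 : vnorm e = 1.
  rewrite /vnorm (bigD1 (Ordinal n0)) //= big1 => [|i i0].
    by rewrite mxE !eqxx addr0 normc_real normr1 expr1n sqrtr1.
  by rewrite mxE (negbTE i0) normc_real normr0 expr0n.
by exists (vnorm (A *m e)), e.
Qed.

(** * Real and imaginary parts *)

Lemma adjmxB A K : adjmx (A - K) = adjmx A - adjmx K.
Proof. by apply/matrixP => i j; rewrite !mxE rmorphB. Qed.

Lemma adjmxD A K : adjmx (A + K) = adjmx A + adjmx K.
Proof. by apply/matrixP => i j; rewrite !mxE rmorphD. Qed.

Lemma adjmxM A K : adjmx (A *m K) = adjmx K *m adjmx A.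
Proof. by rewrite /adjmx trmx_mul map_mxM. Qed.

Lemma adjmxZ a A : adjmx (a *: A) = Num.conj a *: adjmx A.
Proof. by apply/matrixP => i j; rewrite !mxE rmorphM. Qed.

Lemma adjmx_Immx A : adjmx (Immx A) = Immx A.
Proof.
rewrite /Immx adjmxZ adjmxB adjmxK fmorphV rmorphM rmorph_nat /=.
have -> : Num.conj ('i : R[i]) = - 'i.
  by apply/eqP; rewrite eq_complex /= oppr0 !eqxx.
by rewrite mulrN invrN scaleNr -scalerN opprB.
Qed.

Lemma inner_Immx A x :
  inner (Immx A *m x) x = (complex.Im (inner (A *m x) x))%:C.
Proof.
rewrite -scalemxAl mulmxBl -scaleN1r innerZl innerDl innerZl.
rewrite (inner_adjmx (adjmx A)) adjmxK -(conj_inner (A *m x)) mulN1r.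
rewrite -[Num.conj _]/(conjc _) subcJ mulrAC mulKf //.
by rewrite mulf_neq0 ?pnatr_eq0 // eq_complex /= oner_eq0 andbF.
Qed.

Lemma vnorm_Remx A x :
  vnorm (Remx A *m x) = 2^-1 * vnorm (A *m x + adjmx A *m x).
Proof.
rewrite -scalemxAl mulmxDl (vnormZ 2^-1).
by rewrite ComplexField.Normc.normcV normc_nat.
Qed.

Lemma vnorm_Immx A x :
  vnorm (Immx A *m x) = 2^-1 * vnorm (A *m x - adjmx A *m x).
Proof.
rewrite -scalemxAl mulmxBl (vnormZ (2 * 'i)^-1) ComplexField.Normc.normcV.
by rewrite ComplexField.Normc.normcM normc_nat normc_i mulr1.
Qed.

(** The parallelogram law for Ax and A^*x, whose sum and difference have the
    norms 2 ||Hx|| and 2 ||Kx||. *)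
Lemma sqr_vnorm_Remx_Immx A x :
  vnorm (A *m x) ^+ 2 + vnorm (adjmx A *m x) ^+ 2 =
  2 * (vnorm (Remx A *m x) ^+ 2 + vnorm (Immx A *m x) ^+ 2).
Proof.
(* Over bare real variables, so that the arithmetic never has to decide
   whether two of the matrices are equal. *)
have halve (a b c d h k : R) :
    a ^+ 2 + b ^+ 2 = 2 * (c ^+ 2 + d ^+ 2) -> h = 2^-1 * a -> k = 2^-1 * b ->
    c ^+ 2 + d ^+ 2 = 2 * (h ^+ 2 + k ^+ 2).
  by move=> + -> ->; lra.
exact: halve (vnorm_parallelogram _ _) (vnorm_Remx A x) (vnorm_Immx A x).
Qed.

Lemma inner_adjmxM_addC A x :
  inner ((adjmx A *m A + A *m adjmx A) *m x) x =
  (vnorm (A *m x) ^+ 2 + vnorm (adjmx A *m x) ^+ 2)%:C.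
Proof.
rewrite mulmxDl innerDl -!mulmxA (inner_adjmx (adjmx A)) adjmxK.
by rewrite (inner_adjmx A (adjmx A *m x)) raddfD /= -!inner_vnorm.
Qed.
End Inner.

(** * The sectorial estimate *)

(** Squaring cos(alpha) |Im z| <= sin(alpha) Re z and adding
    sin(alpha)^2 (Im z)^2 on both sides gives
    (Im z)^2 <= sin(alpha)^2 |z|^2. *)
Lemma sector_Im_le (R : realType) (alpha : R) (z : R[i]) :
  0 < alpha < pi / 2 -> sector alpha z ->
  `|complex.Im z| <= sin alpha * normc z.
Proof.
case: z => a b /andP[al0 al1] [/= a0 ab].
have c0 : 0 < cos alpha by apply: cos_gt0_pihalf; rewrite al1 andbT; lra.
have s0 : 0 < sin alpha by apply: sin_gt0_pihalf; rewrite al0.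
have cs : cos alpha ^+ 2 + sin alpha ^+ 2 = 1 by exact: cos2Dsin2.
rewrite -(@ler_pXn2r _ 2) ?nnegrE ?mulr_ge0 ?sqrtr_ge0 ?(ltW s0) //.
rewrite real_normK ?num_real // exprMn sqr_sqrtr ?addr_ge0 ?sqr_ge0 //.
have ab_cs : cos alpha * `|b| <= sin alpha * a.
  have -> : sin alpha * a = cos alpha * (tan alpha * a).
    by rewrite mulrA [cos _ * _]mulrC /tan divfK ?gt_eqF.
  by rewrite ler_pM2l.
have : (cos alpha * `|b|) ^+ 2 <= (sin alpha * a) ^+ 2.
  by rewrite lerXn2r ?nnegrE ?mulr_ge0 ?normr_ge0 ?(ltW s0) ?(ltW c0) ?(ltW a0).
rewrite !exprMn real_normK ?num_real // => sqr_le.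
rewrite -[leLHS]mul1r -cs.
by rewrite mulrDl mulrDr lerD2r.
Qed.

Theorem corollary4p3 (R : realType) (n : nat) (alpha : R) (A : 'M[R[i]]_n)
  (n_ge1 : (1 <= n)%N)
  (alpha_ge0 : 0 <= alpha) (alpha_lt : alpha < pi / 2) (alpha_neq0 : alpha <> 0)
  (A_sectorial : sectorial alpha A)
  (le_Re_Im : opnorm (Remx A) <= opnorm (Immx A)) :
  1 / (4 * sin alpha ^+ 2) * opnorm (adjmx A *m A + A *m adjmx A)
    <= numradius A ^+ 2.
Proof.
have al : 0 < alpha < pi / 2.
  by rewrite alpha_lt andbT lt_def alpha_ge0 andbT; apply/eqP.
have s0 : 0 < sin alpha by exact: sin_gt0_pihalf.
have Im_le : opnorm (Immx A) <= sin alpha * numradius A.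
  apply: opnorm_le => //; apply: hermitian_norm_le_form => [|x x1].
    exact: adjmx_Immx.
  rewrite inner_Immx normc_real.
  apply: le_trans (_ : sin alpha * normc (inner (A *m x) x) <= _).
    by apply: sector_Im_le => //; apply: A_sectorial; exists x.
  by rewrite ler_pM2l // numradius_ub.
rewrite div1r ler_pdivrMl ?mulr_gt0 ?exprn_gt0 // -mulrA -exprMn.
apply: opnorm_le => //; apply: hermitian_norm_le_form => [|x x1].
  by rewrite adjmxD !adjmxM adjmxK.
rewrite inner_adjmxM_addC normc_real ger0_norm; last first.
  by rewrite addr_ge0 ?sqr_ge0.
rewrite sqr_vnorm_Remx_Immx.
have sqr_le B : opnorm B <= sin alpha * numradius A ->
    vnorm (B *m x) ^+ 2 <= (sin alpha * numradius A) ^+ 2.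
  move=> B_le; have Bx := le_trans (opnorm_ub B _ x1) B_le.
  by rewrite lerXn2r ?nnegrE ?vnorm_ge0 // (le_trans (vnorm_ge0 _) Bx).
rewrite (natrM _ 2 2) -[leRHS]mulrA ler_pM2l // mulr_natl mulr2n.
exact: lerD (sqr_le _ (le_trans le_Re_Im Im_le)) (sqr_le _ Im_le).
Qed.
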